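(* Let $G$ be a topological group, let $H$ be a compact subgroup of $G$, and let $G/H$ be the quotient space of left cosets with the quotient topology. (1) If $G/H$ is weakly compact-bounded, then $G$ is weakly compact-bounded. (2) If $G/H$ is compact-bounded, then $G$ is compact-bounded.
   Context: All topological spaces (in particular all topological groups) are assumed to be Hausdorff. A space $X$ is compact-bounded if for every countable family $\mathcal U$ of non-empty open subsets of $X$ there is a compact $K\subset X$ which meets each element of $\mathcal U$. A space $X$ is weakly compact-bounded if for every infinite countable family $\mathcal U$ of non-empty open subsets of $X$ there is a compact $K\subset X$ which meets infinitely many elements of $\mathcal U$. *)

(* Defs.v *)
From HB Require Import structures.
From mathcomp Require Import all_boot generic_quotient all_classical topology.

Set Implicit Arguments.
Unset Strict Implicit.
Unset Printing Implicit Defensive.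

Local Open Scope classical_set_scope.
Local Open Scope group_scope.
Local Open Scope quotient_scope.

HB.mixin Record Group_isTopologicalGroup G & Topological G & Group G := {
  mulg_continuous : continuous (fun x : G * G => x.1 * x.2);
  invg_continuous : continuous (fun x : G => x^-1)
}.

(* As elsewhere in the library, the Hausdorff axiom is kept as the separate
   predicate [hausdorff_space]. *)
#[short(type="topologicalGroupType")]
HB.structure Definition TopologicalGroup :=
  {G of Topological G & Group G & Group_isTopologicalGroup G}.

Definition lcoset_set (G : groupType) (H : groupClosed G) (x : G) : set G :=
  [set x * h | h in [set` H]].

Definition lcoset_eq (G : groupType) (H : groupClosed G) : rel G :=
  fun x y => `[< lcoset_set H x = lcoset_set H y >].

Lemma lcoset_eq_equiv (G : groupType) (H : groupClosed G) :
  equiv_class_of (lcoset_eq H).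
Proof.
split=> [x|x y|y x z]; first exact/asboolP.
- by apply/asboolP/asboolP => ->.
- by move=> /asboolP xy /asboolP yz; apply/asboolP; rewrite xy.
Qed.

Canonical lcoset_equivRel (G : groupType) (H : groupClosed G) :=
  EquivRelPack (lcoset_eq_equiv H).

(* Points are the left cosets xH, represented in the quotient type;
   [lcoset_pi H x] is the point xH. *)
Definition lcoset_space (G : topologicalGroupType) (H : groupClosed G) :
    topologicalType :=
  quotient_topology {eq_quot (lcoset_eq H)}.

Definition lcoset_pi (G : topologicalGroupType) (H : groupClosed G) (x : G) :
    lcoset_space H :=
  \pi_{eq_quot (lcoset_eq H)} x.

Lemma lcoset_piP (G : topologicalGroupType) (H : groupClosed G) (x y : G) :
  lcoset_pi H x = lcoset_pi H y <-> lcoset_set H x = lcoset_set H y.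
Proof.
have e : reflect (lcoset_pi H x = lcoset_pi H y) (lcoset_eq H x y).
  exact: (@eqmodP _ (lcoset_equivRel H)).
by split=> [/e/asboolP|/asboolP/e].
Qed.

Lemma lcoset_pi_surj (G : topologicalGroupType) (H : groupClosed G)
    (u : lcoset_space H) :
  exists x : G, u = lcoset_pi H x.
Proof.
by exists (repr (u : {eq_quot (lcoset_eq H)})); rewrite /lcoset_pi reprK.
Qed.

Lemma lcoset_openE (G : topologicalGroupType) (H : groupClosed G)
    (U : set (lcoset_space H)) :
  open U = open (lcoset_pi H @^-1` U).
Proof. by []. Qed.

Definition compact_bounded (X : topologicalType) : Prop :=
  forall U : set (set X), countable U ->
    (forall A, U A -> open A /\ A !=set0) ->
    exists2 K : set X, compact K & forall A, U A -> K `&` A !=set0.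

Definition weakly_compact_bounded (X : topologicalType) : Prop :=
  forall U : set (set X), infinite_set U -> countable U ->
    (forall A, U A -> open A /\ A !=set0) ->
    exists2 K : set X, compact K & infinite_set [set A | U A /\ K `&` A !=set0].

(* Main.v *)
(** The projection [G -> G/H] is open, and, because [H] is compact, it pulls
    compact sets back to compact sets. So one applies the hypothesis to the
    family of images [pi A] and pulls the resulting compact set back. In (1) the
    family of images may be finite even if the given family is infinite; then a
    finite set with one point in each image serves as the compact set. *)
Require Import Defs.
From mathcomp Require Import all_boot generic_quotient all_classical topology.

Local Open Scope classical_set_scope.

Section CompactSubgroupQuotient.
Variables (G : topologicalGroupType) (H : groupClosed G).
Local Notation pi := (@lcoset_pi G H).

Lemma lcoset_pi_eq (x y : G) :
  pi x = pi y <-> exists2 h, h \in H & y = (x * h)%g.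
Proof.
rewrite lcoset_piP; split=> [xy|[h Hh ->]].
  have : lcoset_set H y y by exists 1%g; [exact: gpred1|rewrite mulg1].
  by rewrite -xy => -[h Hh <-]; exists h.
rewrite /lcoset_set; apply/seteqP; split=> _ [k Hk <-].
  exists (h^-1 * k)%g; last by rewrite mulgA mulgK.
  by rewrite /= gpredM // gpredVr.
by exists (h * k)%g; [exact: gpredM|rewrite mulgA].
Qed.

Lemma mulgr_continuous (h : G) : continuous (fun x : G => (x * h)%g).
Proof.
move=> x; apply: (continuous2_cvg _ (h := fun a b : G => (a * b)%g)).
- exact: (@mulg_continuous G (x, h)).
- exact: cvg_id.
- exact: cvg_cst.
Qed.

(** The saturation of [V] is the union over [h] in [H] of the preimages of [V] under right
    translation by [h], each of them open. *)
Lemma lcoset_pi_open (V : set G) : open V -> open (pi @` V).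
Proof.
move=> oV; rewrite lcoset_openE.
rewrite (_ : _ @^-1` _ =
  \bigcup_(h in [set` H]) ((fun x : G => (x * h)%g) @^-1` V)).
  apply: bigcup_open => h _; apply: open_comp => // x _.
  exact: mulgr_continuous.
apply/seteqP; split=> [y [v Vv /esym/lcoset_pi_eq[h Hh vE]]|y [h Hh Vyh]].
  by exists h => //=; rewrite -vE.
by exists (y * h)%g => //; apply/esym/lcoset_pi_eq; exists h.
Qed.

Lemma nbhs_lcoset_pi (x : G) (V : set G) : nbhs x V -> nbhs (pi x) (pi @` V).
Proof.
rewrite !nbhsE => -[W [oW Wx] WV]; exists (pi @` W); last exact: image_subset.
by split; [exact: lcoset_pi_open|exists x].
Qed.

Lemma compact_lcoset_preimage (K : set (lcoset_space H)) :
  compact [set` H] -> compact K -> compact (pi @^-1` K).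
Proof.
move=> cH cK F PF FK.
have [u [Ku clu]] := cK (pi @ F) _ FK.
have [x uE] := lcoset_pi_surj u; rewrite {}uE in Ku clu.
(* If [pi x] is a cluster point of [pi F], the elements [h] of [H] with [v h] in
   [S], for [v] close to [x] and [S] in [F], form a filter base; a cluster point
   [h] of it yields the cluster point [x h] of [F]. *)
pose D := [set VS : set G * set G | nbhs x VS.1 /\ F VS.2].
pose B (VS : set G * set G) :=
  [set h : G | h \in H /\ exists2 v, VS.1 v & VS.2 (v * h)%g].
have PB : ProperFilter (filter_from D B).
  apply: filter_from_proper; first apply: filter_from_filter.
  - by exists (setT, setT); split; exact: filterT.
  - move=> [V S] [V' S'] [/= nV FS] [/= nV' FS'].
    exists (V `&` V', S `&` S'); first by split; exact: filterI.
    by move=> h [Hh [v [Vv V'v] [Sv S'v]]]; split; split=> //; exists v.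
  (* Since [pi] is open, the image of [V] is a neighbourhood of the cluster point [pi x], so it
     meets the image of [S]: some [s] in [S] and [v] in [V] share a coset, and [s = v h] puts [h] in
     [B (V, S)]. *)
  - move=> [V S] [/= nV FS].
    have FpS : (pi @ F) (pi @` S).
      by exact: filterS (@preimage_image _ _ pi S) FS.
    have [_ [[s Ss <-] [v Vv /lcoset_pi_eq[h Hh sE]]]] :=
      clu _ _ FpS (nbhs_lcoset_pi _ _ nV).
    by exists h; split=> //; exists v => //=; rewrite -sE.
have [|h [Hh clh]] := cH _ PB.
  by exists (setT, setT); [split; exact: filterT|move=> h []].
exists (x * h)%g; split.
  by rewrite /= -(proj2 (lcoset_pi_eq x (x * h)%g)) //; exists h.
(* Continuity of the product at [(x, h)] gives [V V'] inside [W]. Any [k] in both [B (V, S)] and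
   [V'] then yields a point [v k] of [S] and [W]. *)
move=> S W FS /(@mulg_continuous G (x, h))[[V V'] /= [nV nV'] VW].
have [|k [[Hk [v Vv Sk]] V'k]] := clh (B (V, S)) V' _ nV'.
  by exists (V, S).
by exists (v * k)%g; split=> //; exact: (VW (v, k)).
Qed.

Lemma lcoset_preimage_meet (K : set (lcoset_space H)) (A : set G) :
  K `&` pi @` A !=set0 -> pi @^-1` K `&` A !=set0.
Proof. by move=> [y [Ky [x Ax xE]]]; exists x; split=> //=; rewrite xE. Qed.

End CompactSubgroupQuotient.

Theorem proposition4p1 (G : topologicalGroupType) (H : groupClosed G)
    (hausG : hausdorff_space G) (compactH : compact [set` H]) :
  (weakly_compact_bounded (lcoset_space H) -> weakly_compact_bounded G)
  /\ (compact_bounded (lcoset_space H) -> compact_bounded G).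
Proof.
pose p (A : set G) := lcoset_pi H @` A.
have open_image (U : set (set G)) : (forall A, U A -> open A /\ A !=set0) ->
    forall B, (p @` U) B -> open B /\ B !=set0.
  move=> Uo _ [A UA <-]; have [oA [a Aa]] := Uo _ UA.
  by split; [exact: lcoset_pi_open|exists (lcoset_pi H a); exists a].
split=> bH U.
  move=> infU cU Uo; have [finpU|infpU] := pselect (finite_set (p @` U)).
    have [f fP] : {f : set (lcoset_space H) -> lcoset_space H |
        forall B, (p @` U) B -> B (f B)}.
      (* The class of [1] is only a default value, for sets outside the family of images. *)
      have fB B : exists y, (p @` U) B -> B y.
        have [/open_image[//|_ [y By]]|nB] := pselect ((p @` U) B).
          by exists y.
        by exists (lcoset_pi H 1%g).
      by exists (fun B => projT1 (cid (fB B))) => B; exact: projT2 (cid (fB B)).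
    exists (lcoset_pi H @^-1` (f @` (p @` U))).
      apply: compact_lcoset_preimage => //.
      by apply: finite_compact; exact: finite_image.
    (* Here the compact set meets every member of [U], not just infinitely many. *)
    rewrite (_ : [set A | _] = U) //.
    apply/seteqP; split=> [A []//|A UA]; split=> //.
    apply: lcoset_preimage_meet; exists (f (p A)); split.
      by exists (p A) => //; exists A.
    by apply: fP; exists A.
  have [K cK infK] :=
    bH _ infpU (sub_countable (card_image_le p U) cU) (open_image _ Uo).
  exists (lcoset_pi H @^-1` K); first exact: compact_lcoset_preimage.
  (* If only finitely many [A] met the preimage of [K], their images would be the only [p A] meeting
     [K]. *)
  move=> finK; apply: infK.
  apply: (sub_finite_set _ (finite_image p finK)) => _ [[A UA <-] KA].
  by exists A => //; split=> //; exact: lcoset_preimage_meet.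
move=> cU Uo.
have [K cK KU] :=
  bH _ (sub_countable (card_image_le p U) cU) (open_image _ Uo).
exists (lcoset_pi H @^-1` K); first exact: compact_lcoset_preimage.
by move=> A UA; apply: lcoset_preimage_meet; apply: KU; exists A.
Qed.
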